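(* Let $A_\Gamma$ be a right-angled Artin group. If a subgroup $H\subset A_\Gamma$ is an $\mathrm{F}\mathcal{A}'$-group, then $H$ is trivial.
   Context: Let $\Gamma$ be a finite non-empty simplicial graph with vertex set $V(\Gamma)$, edge set $E(\Gamma)$ and an edge-labeling $m\colon E(\Gamma)\to\{2,3,4,\ldots\}$. The Artin group $A_\Gamma$ is the group with generating set $V(\Gamma)$ and relations $vwv\cdots = wvw\cdots$ (both sides alternating words with $m(\{v,w\})$ letters) for each $\{v,w\}\in E(\Gamma)$. It is right-angled if $E(\Gamma)=\emptyset$ or $m(E(\Gamma))=\{2\}$. A group $G$ is an $\mathrm{F}\mathcal{A}'$-group if every simplicial action of $G$ on a tree without inversion is locally elliptic, i.e. every element of $G$ has a fixed point in the tree. *)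

(* Defs.v *)
From HB Require Import structures.
From mathcomp Require Import all_boot.
From mathcomp Require Import boolp.

Set Implicit Arguments.
Unset Strict Implicit.
Unset Printing Implicit Defensive.

Local Open Scope group_scope.
Local Open Scope quotient_scope.

Section Presentation.

Variable X : choiceType.

(* The letter [(x, true)] stands for x, and [(x, false)] for x^-1. *)
Definition word := seq (X * bool).

Definition inv_letter (l : X * bool) : X * bool := (l.1, ~~ l.2).

Definition inv_word (w : word) : word := rev (map inv_letter w).

Variable R : word -> word -> Prop.

Inductive word_eq : word -> word -> Prop :=
| word_eq_refl w : word_eq w w
| word_eq_sym u v : word_eq u v -> word_eq v u
| word_eq_trans u v w : word_eq u v -> word_eq v w -> word_eq u w
| word_eq_cat u u' v v' :
    word_eq u u' -> word_eq v v' -> word_eq (u ++ v) (u' ++ v')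
| word_eq_cancel l : word_eq [:: l; inv_letter l] [::]
| word_eq_rel u v : R u v -> word_eq u v.

Definition word_eqb (u v : word) : bool := `[< word_eq u v >].

Lemma word_eqb_refl : reflexive word_eqb.
Proof. by move=> w; apply/asboolP; apply: word_eq_refl. Qed.

Lemma word_eqb_sym : symmetric word_eqb.
Proof.
by move=> u v; apply/asboolP/asboolP; apply: word_eq_sym.
Qed.

Lemma word_eqb_trans : transitive word_eqb.
Proof.
move=> v u w /asboolP uv /asboolP vw; apply/asboolP.
exact: word_eq_trans uv vw.
Qed.

Canonical word_eq_equiv :=
  EquivRel word_eqb word_eqb_refl word_eqb_sym word_eqb_trans.

Definition presented := {eq_quot word_eqb}.

HB.instance Definition _ := Choice.on presented.

Definition class_of_word (w : word) : presented := \pi_{eq_quot word_eqb} w.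

Definition word_of_class (x : presented) : word :=
  repr (x : {eq_quot word_eqb}).

Lemma word_of_classK : cancel word_of_class class_of_word.
Proof. by move=> x; rewrite /class_of_word /word_of_class reprK. Qed.

Lemma class_of_wordP (u v : word) :
  class_of_word u = class_of_word v <-> word_eq u v.
Proof.
split=> [/eqmodP/asboolP // | uv].
by apply/eqmodP/asboolP.
Qed.

Lemma class_of_wordK (w : word) : word_eq (word_of_class (class_of_word w)) w.
Proof. by apply/class_of_wordP; rewrite word_of_classK. Qed.

Definition presented_one : presented := class_of_word [::].

Definition presented_mul (x y : presented) : presented :=
  class_of_word (word_of_class x ++ word_of_class y).

Definition presented_inv (x : presented) : presented :=
  class_of_word (inv_word (word_of_class x)).

Lemma inv_letterK : involutive inv_letter.
Proof. by case=> x b; rewrite /inv_letter /= negbK. Qed.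

Lemma inv_wordK : involutive inv_word.
Proof.
by move=> w; rewrite /inv_word map_rev revK mapK //; apply: inv_letterK.
Qed.

Lemma word_eq_mulV (w : word) : word_eq (w ++ inv_word w) [::].
Proof.
elim: w => [|l w IHw]; first exact: word_eq_refl.
rewrite /inv_word /= rev_cons -cats1 -/(inv_word w).
have -> : l :: w ++ inv_word w ++ [:: inv_letter l]
          = [:: l] ++ ((w ++ inv_word w) ++ [:: inv_letter l]).
  by rewrite /= catA.
apply: word_eq_trans (word_eq_cancel l).
rewrite -[[:: l; _]]/([:: l] ++ ([::] ++ [:: inv_letter l])).
apply: word_eq_cat; first exact: word_eq_refl.
by apply: word_eq_cat => //; exact: word_eq_refl.
Qed.

Lemma presented_mulA : associative presented_mul.
Proof.
move=> x y z; apply/class_of_wordP.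
apply: (@word_eq_trans _ ((word_of_class x ++ word_of_class y)
                            ++ word_of_class z)).
  rewrite -catA; apply: word_eq_cat; first exact: word_eq_refl.
  exact: class_of_wordK.
apply: word_eq_cat; last exact: word_eq_refl.
by apply: word_eq_sym; exact: class_of_wordK.
Qed.

Lemma presented_mul1 : left_id presented_one presented_mul.
Proof.
move=> x; rewrite -[RHS]word_of_classK; apply/class_of_wordP.
rewrite -[X in word_eq _ X]cat0s.
by apply: word_eq_cat; [exact: class_of_wordK | exact: word_eq_refl].
Qed.

Lemma presented_mulr1 : right_id presented_one presented_mul.
Proof.
move=> x; rewrite -[RHS]word_of_classK; apply/class_of_wordP.
rewrite -[X in word_eq _ X]cats0.
by apply: word_eq_cat; [exact: word_eq_refl | exact: class_of_wordK].
Qed.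

Lemma presented_mulrV :
  right_inverse presented_one presented_inv presented_mul.
Proof.
move=> x; apply/class_of_wordP.
apply: word_eq_trans (word_eq_mulV (word_of_class x)).
by apply: word_eq_cat; [exact: word_eq_refl | exact: class_of_wordK].
Qed.

Lemma presented_mulVr :
  left_inverse presented_one presented_inv presented_mul.
Proof.
move=> x; apply/class_of_wordP.
apply: word_eq_trans (word_eq_mulV (inv_word (word_of_class x))).
rewrite inv_wordK.
by apply: word_eq_cat; [exact: class_of_wordK | exact: word_eq_refl].
Qed.

HB.instance Definition _ := isGroup.Build presented
  presented_mulA presented_mul1 presented_mulr1
  presented_mulVr presented_mulrV.

End Presentation.

Record labeled_graph := LabeledGraph {
  vertices : finType;
  vertices_gt0 : 0 < #|vertices|;
  edges : {set {set vertices}};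
  edges_card2 : forall e, e \in edges -> #|e| = 2;
  (* Only the values of [label] on [edges] are ever used. *)
  label : {set vertices} -> nat;
  label_ge2 : forall e, e \in edges -> 2 <= label e
}.

(* The alternating word v w v w ... with n letters. *)
Fixpoint alternating (X : choiceType) (n : nat) (v w : X) : word X :=
  if n is n'.+1 then (v, true) :: alternating n' w v else [::].

Inductive artin_relation (Gamma : labeled_graph) :
    word (vertices Gamma) -> word (vertices Gamma) -> Prop :=
| ArtinRelation (v w : vertices Gamma) of [set v; w] \in edges Gamma :
    artin_relation (alternating (label [set v; w]) v w)
                   (alternating (label [set v; w]) w v).

Definition artin_group (Gamma : labeled_graph) : groupType :=
  presented (@artin_relation Gamma).

Definition right_angled (Gamma : labeled_graph) : Prop :=
  edges Gamma = set0 \/ [seq label e | e in edges Gamma] =i pred1 2.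

Definition subgroup_type (G : groupType) (H : groupClosed G) :=
  {x : G | x \in H}.

Section SubgroupType.

Variables (G : groupType) (H : groupClosed G).

Lemma subgroup_type_closed : group_closed (fun x : G => x \in H).
Proof. by split; [exact: gpred1 | move=> x y; exact: gpredF]. Qed.

HB.instance Definition _ := SubChoice.on (subgroup_type H).

HB.instance Definition _ :=
  SubChoice_isSubGroup.Build G (fun x : G => x \in H) (subgroup_type H)
    subgroup_type_closed.

End SubgroupType.

(* Simplicial trees with an arbitrary, possibly infinite, vertex set. Asking
   for an [eqType] and a boolean adjacency relation is no restriction in the
   presence of the axioms of [boolp]. A closed walk without repeated vertices
   has at most two vertices exactly when it is not a circuit. *)
Record tree := Tree {
  tree_vertex :> eqType;
  adj : rel tree_vertex;
  adj_sym : symmetric adj;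
  adj_irrefl : irreflexive adj;
  tree_nonempty : exists x : tree_vertex, True;
  tree_connected : forall x y : tree_vertex,
    exists2 p : seq tree_vertex, path adj x p & last x p = y;
  tree_acyclic : forall c : seq tree_vertex, ucycle adj c -> size c <= 2
}.

Record tree_action (G : groupType) (T : tree) := TreeAction {
  act :> G -> T -> T;
  act1 : forall x, act 1 x = x;
  actM : forall g h x, act (g * h) x = act g (act h x);
  act_adj : forall g x y, adj (act g x) (act g y) = adj x y
}.

Definition without_inversion (G : groupType) (T : tree)
    (a : tree_action G T) : Prop :=
  forall (g : G) (x y : T), adj x y -> ~ (a g x = y /\ a g y = x).

(* For an action without inversion, an element fixing a point in the interior
   of an edge fixes both endpoints of that edge, so fixed points may be looked
   for among the vertices. *)
Definition locally_elliptic (G : groupType) (T : tree)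
    (a : tree_action G T) : Prop :=
  forall g : G, exists x : T, a g x = x.

Definition FA'_group (G : groupType) : Prop :=
  forall (T : tree) (a : tree_action G T),
    without_inversion a -> locally_elliptic a.

(* Main.v *)
Require Import Defs.
From HB Require Import structures.
From mathcomp Require Import all_boot.
From mathcomp Require Import boolp.

Set Implicit Arguments.
Unset Strict Implicit.
Unset Printing Implicit Defensive.

Local Open Scope group_scope.

(**
Write A for the right-angled Artin group. For a vertex v let [kill v] be the
endomorphism of A sending v to 1 and fixing the other generators.

For each v the group A acts without inversion on a tree in such a way that an
element fixing a vertex is conjugate to its image under [kill v]
([fixed_vertex_conj], [splittingK]). An element x of a subgroup with property
FA' fixes a vertex in each of these trees, so x is conjugate to [kill v x] for
every v. Conjugacy is preserved by endomorphisms, hence x is conjugate to its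
image under the composite of all the [kill v]; that composite kills every
generator, so x is conjugate to 1 ([conj_kill_trivial]).

The tree is a variant of the Bass-Serre tree of the splitting of A as an HNN
extension of the subgroup generated by the vertices other than v, with stable
letter v. The normal closure of v in A is free on the conjugates of v by that
subgroup, so this Bass-Serre tree is the Cayley tree of that free group.
Proving freeness would need normal forms in A. They are avoided by taking a
larger tree: let F(A) be the free group on the underlying set of A, on which A
acts by conjugating the basis elements, and consider F(A) x| A. The group A maps
to it by v |-> ([v], 1) and w |-> (1, w) for w <> v; an edge {v, w} gives a
valid relation because w conjugates v to itself. Evaluating formal products in A
defines a morphism (u, a) |-> ev(u) a from F(A) x| A back to A, and this is a
left inverse of the embedding. The semidirect product acts on the Cayley tree of
F(A), and if (u, a) fixes w, that is, u (a.w) = w, then evaluating this equation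
gives ev(u) (a ev(w) a^-1) = ev(w): the element ev(u) a is conjugate to a by
ev(w). For the image of x this reads: x is conjugate to [kill v x].

The only combinatorial input is that the Cayley graph of a free group is a tree
([cayley_acyclic]), which follows from the invariance of free reduction
([reduce_eq]).
*)

(** * Morphisms out of a presented group *)

Section UniversalProperty.

Variables (X : choiceType) (R : word X -> word X -> Prop) (G : groupType).

Definition letter_value (f : X -> G) (l : X * bool) : G :=
  if l.2 then f l.1 else (f l.1)^-1.

Definition word_value (f : X -> G) (w : word X) : G :=
  \prod_(l <- w) letter_value f l.

Definition respects (f : X -> G) : Prop :=
  forall u v, R u v -> word_value f u = word_value f v.

Lemma word_value_eq f u v :
  respects f -> word_eq R u v -> word_value f u = word_value f v.
Proof.
move=> fR; elim=> {u v} [//|//|u v w _ -> _ -> //|u u' v v' _ IHu _ IHv|l|].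
- by rewrite /word_value !big_cat /= -!/(word_value f _) IHu IHv.
- rewrite /word_value big_cons big_seq1 big_nil; case: l => x [];
    by rewrite /letter_value /= (mulgV, mulVg).
- exact: fR.
Qed.

Definition letter (l : X * bool) : presented R := class_of_word R [:: l].
Definition gen (x : X) : presented R := letter (x, true).

Lemma class_of_word_cat u v :
  class_of_word R (u ++ v) = class_of_word R u * class_of_word R v.
Proof.
by apply/class_of_wordP; apply: word_eq_cat; apply: word_eq_sym;
  exact: class_of_wordK.
Qed.

Lemma letterV l : (letter l)^-1 = letter (inv_letter l).
Proof.
apply: mulg1_eq; rewrite -class_of_word_cat.
by apply/class_of_wordP; exact: word_eq_cancel.
Qed.

Lemma word_generated (P : presented R -> Prop) :
  P 1 -> (forall l x, P x -> P (letter l * x)) -> forall x, P x.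
Proof.
move=> P1 PM x; rewrite -(word_of_classK x).
elim: (word_of_class x) => [//|l w IHw].
by rewrite -cat1s class_of_word_cat; exact: PM.
Qed.

Lemma letter_inv_gen x : letter (x, false) = (gen x)^-1.
Proof. by rewrite letterV. Qed.

Lemma gen_generated (P : presented R -> Prop) :
  P 1 -> (forall x u, P u -> P (gen x * u)) ->
  (forall x u, P u -> P ((gen x)^-1 * u)) -> forall u, P u.
Proof.
move=> P1 Pgen PgenV; elim/word_generated=> // -[x []] u Pu; first exact: Pgen.
by rewrite letter_inv_gen; exact: PgenV.
Qed.

(** Morphisms out of a presented group are determined on generators; all the
    identities between morphisms below are checked in this way. *)
Lemma morphism_ext (f g : UMagmaMorphism.type (presented R) G) :
  (forall x, f (gen x) = g (gen x)) -> f =1 g.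
Proof.
move=> fg; elim/gen_generated => [|x u IHu|x u IHu]; first by rewrite !gmulf1.
  by rewrite !gmulfM IHu fg.
by rewrite !gmulfM !gmulfV IHu fg.
Qed.

Definition lift (f : X -> G) of respects f : presented R -> G :=
  fun x => word_value f (word_of_class x).

Variables (f : X -> G) (fR : respects f).

Lemma lift_class w : lift fR (class_of_word R w) = word_value f w.
Proof. by apply: word_value_eq => //; exact: class_of_wordK. Qed.

Lemma lift_morphism : monoid_morphism (lift fR).
Proof.
split=> [|x y]; first by rewrite lift_class /word_value big_nil.
rewrite -(word_of_classK x) -(word_of_classK y) -class_of_word_cat !lift_class.
by rewrite /word_value big_cat.
Qed.

HB.instance Definition _ :=
  isUMagmaMorphism.Build (presented R) G (lift fR) lift_morphism.

Lemma lift_gen x : lift fR (gen x) = f x.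
Proof. by rewrite lift_class /word_value big_seq1. Qed.

End UniversalProperty.

Arguments letter {X R} l.
Arguments gen {X R} x.

(** * The Cayley tree of a free group *)

Section FreeGroup.

Variable X : choiceType.

Definition no_relation (u v : word X) : Prop := False.

Definition free_group : groupType := presented no_relation.

(** Left multiplication by a letter on freely reduced words: the head is
    cancelled when it is the inverse letter. *)
Definition reduce_cons (l : X * bool) (w : word X) : word X :=
  if w is h :: t then if h == inv_letter l then t else l :: w else [:: l].

Definition reduce (w : word X) : word X := foldr reduce_cons [::] w.

Definition reduced (w : word X) : bool :=
  sorted (fun l h => h != inv_letter l) w.

Lemma reduce_cons_reduced l w : reduced w -> reduced (reduce_cons l w).
Proof.
case: w => [//|h t] /= ht; case: eqP => [_|/eqP hl].
  exact: path_sorted ht.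
by rewrite /= hl.
Qed.

Lemma foldr_reduced u w : reduced w -> reduced (foldr reduce_cons w u).
Proof. by move=> wr; elim: u => //= l u; exact: reduce_cons_reduced. Qed.

(** This fails without reducedness: on [l :: inv_letter l :: t] both steps
    cancel and [t] is left. It makes the letters act by mutually inverse
    bijections on reduced words, so that the free group acts on them. *)
Lemma reduce_consK l w :
  reduced w -> reduce_cons l (reduce_cons (inv_letter l) w) = w.
Proof.
case: w => [|h t] /=; first by rewrite eqxx.
rewrite inv_letterK; case: (h =P l) => [->|_ _] /=; last by rewrite eqxx.
by case: t => [//|k t] /= /andP[/negPf->].
Qed.

(** Van der Waerden's argument: congruent words act in the same way on reduced
    words, and the action of a word on the empty word is its reduced form. *)
Lemma foldr_reduce_eq u v : word_eq no_relation u v ->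
  forall w, reduced w -> foldr reduce_cons w u = foldr reduce_cons w v.
Proof.
elim=> {u v} [//|u v _ IH w wr|u v w _ IHu _ IHv s sr
             |u u' v v' _ IHu _ IHv w wr|l w wr|//].
- by rewrite IH.
- by rewrite IHu ?IHv.
- by rewrite !foldr_cat IHv // IHu //; exact: foldr_reduced.
- exact: reduce_consK.
Qed.

Lemma reduce_eq u v : word_eq no_relation u v -> reduce u = reduce v.
Proof. by move/foldr_reduce_eq; apply. Qed.

Lemma class_reduce w :
  class_of_word no_relation (reduce w) = class_of_word no_relation w.
Proof.
elim: w => [//|l w IHw]; rewrite -[RHS]/(class_of_word _ ([:: l] ++ w)).
rewrite class_of_word_cat -IHw -[reduce _]/(reduce_cons l (reduce w)).
case: (reduce w) => [|h t] /=; first by rewrite mulg1.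
case: eqP => [->|_]; last by rewrite -class_of_word_cat.
rewrite -[_ :: t]cat1s class_of_word_cat -!/(letter _).
by rewrite -letterV mulVKg.
Qed.

Lemma letter_neq1 l : letter l <> 1 :> free_group.
Proof. by move/class_of_wordP/reduce_eq. Qed.

Lemma gen_mul_gen_neq1 x y : gen x * gen y <> 1 :> free_group.
Proof.
by rewrite -class_of_word_cat => /class_of_wordP/reduce_eq /=; case: eqP.
Qed.

(** Edges come from right multiplication, so that the group acts on the graph
    by left multiplication. *)
Definition cayley_adj (u v : free_group) : bool :=
  `[< exists l, v = u * letter l >].

Lemma cayley_adjP u v :
  reflect (exists l, v = u * letter l) (cayley_adj u v).
Proof. exact: asboolP. Qed.

Lemma cayley_adj_sym : symmetric cayley_adj.
Proof.
have half u v : cayley_adj u v -> cayley_adj v u.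
  case/cayley_adjP=> l ->; apply/cayley_adjP; exists (inv_letter l).
  by rewrite -letterV mulgK.
by move=> u v; apply/idP/idP; exact: half.
Qed.

Lemma cayley_adj_gen u v :
  cayley_adj u v <-> exists x, v = u * gen x \/ u = v * gen x.
Proof.
split=> [/cayley_adjP[[x []] ->]|[x [->|->]]].
- by exists x; left.
- by exists x; right; rewrite letter_inv_gen mulgVK.
- by apply/cayley_adjP; exists (x, true).
- by rewrite cayley_adj_sym; apply/cayley_adjP; exists (x, true).
Qed.

Lemma cayley_adj_irrefl : irreflexive cayley_adj.
Proof.
move=> u; apply/negP=> /cayley_adjP[l].
by rewrite -{1}[u]mulg1 => /mulgI/esym; exact: letter_neq1.
Qed.

Lemma cayley_connected u v :
  exists2 p, path cayley_adj u p & last u p = v.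
Proof.
rewrite -[v](mulVKg u); move: (_ * v) => w {v}.
elim/word_generated: w u => [|l w IHw] u; first by exists [::]; rewrite ?mulg1.
have [p pP lastp] := IHw (u * letter l).
exists (u * letter l :: p); rewrite /= ?pP ?andbT ?lastp ?mulgA //.
by apply/cayley_adjP; exists l.
Qed.

(** The reversed reduced word of u with all letters inverted. Moving along an
    edge from u multiplies u on the right, hence u^-1 on the left, so it changes
    [spine u] at its head only; the parent of a vertex, seen from 1, is
    obtained by [behead]. *)
Definition spine (u : free_group) : word X := reduce (word_of_class u^-1).

Lemma spine_inj : injective spine.
Proof.
move=> u v /(congr1 (class_of_word no_relation)).
by rewrite !class_reduce !word_of_classK; exact: invg_inj.
Qed.

Lemma spine_mul_letter u l :
  spine (u * letter l) = reduce_cons (inv_letter l) (spine u).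
Proof.
rewrite /spine invgM letterV -[RHS]/(reduce (inv_letter l :: _)).
apply: reduce_eq; apply/class_of_wordP.
by rewrite word_of_classK -cat1s class_of_word_cat word_of_classK.
Qed.

Lemma cayley_parent u v : cayley_adj u v -> size (spine v) <= size (spine u) ->
  spine v = behead (spine u).
Proof.
case/cayley_adjP=> l ->; rewrite spine_mul_letter.
case: (spine u) => [|h t] //=; case: eqP => //= _; by rewrite ltnn.
Qed.

(** In a circuit, both neighbours of a vertex at maximal distance from 1 are the
    parent of that vertex, so they coincide. *)
Lemma cayley_acyclic c : ucycle cayley_adj c -> size c <= 2.
Proof.
case: c => [//|x0 c0]; set c := x0 :: c0 => /andP[cP cU].
have [x xc xmax] :
    exists2 x, x \in c & forall y, y \in c -> size (spine y) <= size (spine x).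
  pose level (i : 'I_(size c)) := size (spine (nth x0 c i)).
  have [//|i _ imax] := @arg_maxnP _ ord0 xpredT level.
  exists (nth x0 c i) => [|y]; first exact: mem_nth.
  rewrite -index_mem => yc.
  have := imax (Ordinal yc) isT; rewrite /level /= nth_index -?index_mem //.
have [i s def_s] := rot_to xc.
have sP : cycle cayley_adj (x :: s) by rewrite -def_s rot_cycle.
have sU : uniq (x :: s) by rewrite -def_s rot_uniq.
have s_sub z : z \in s -> size (spine z) <= size (spine x).
  by move=> zs; rewrite xmax // -(mem_rot i) def_s inE zs orbT.
rewrite -(size_rot i) def_s; case: s {def_s} sP sU s_sub => [//|y s].
case/lastP: s => [//|s z] /= /andP[xy]; rewrite rcons_path last_rcons.
case/andP=> _ zx /and3P[_ yU _] s_sub.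
case/negP: yU; suff -> : y = z by rewrite mem_rcons mem_head.
apply: spine_inj; rewrite (cayley_parent xy) ?(s_sub y) ?mem_head //.
rewrite cayley_adj_sym in zx.
by rewrite (cayley_parent zx) // s_sub // inE mem_rcons mem_head orbT.
Qed.

Definition cayley_tree : tree :=
  Tree cayley_adj_sym cayley_adj_irrefl (ex_intro _ (1 : free_group) I)
       cayley_connected cayley_acyclic.

Lemma free_respects (G : groupType) (f : X -> G) : respects no_relation f.
Proof. by []. Qed.

Definition free_lift (G : groupType) (f : X -> G) : free_group -> G :=
  lift (free_respects f).

HB.instance Definition _ G f := UMagmaMorphism.copy (@free_lift G f)
  (lift (free_respects f)).

Lemma free_lift_gen (G : groupType) (f : X -> G) x : free_lift f (gen x) = f x.
Proof. exact: lift_gen. Qed.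

End FreeGroup.

(** * The free group on the elements of a group K, extended by K *)

Section SemidirectProduct.

Variable K : groupType.

Definition relabel (a : K) : free_group K -> free_group K :=
  free_lift (fun x => gen (x ^ a^-1)).

HB.instance Definition _ a := UMagmaMorphism.copy (relabel a)
  (free_lift (fun x => gen (x ^ a^-1) : free_group K)).

Lemma relabel_gen a x : relabel a (gen x) = gen (x ^ a^-1).
Proof. exact: free_lift_gen. Qed.

Lemma relabel1 u : relabel 1 u = u.
Proof.
apply: (morphism_ext (f := relabel 1) (g := idfun)) => x.
by rewrite [LHS]relabel_gen invg1 conjg1.
Qed.

Lemma relabelM a b u : relabel (a * b) u = relabel a (relabel b u).
Proof.
apply: (morphism_ext (f := relabel (a * b)) (g := relabel a \o relabel b)) => x.
by rewrite /= !relabel_gen invgM conjgM.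
Qed.

Definition evaluate : free_group K -> K := free_lift id.

HB.instance Definition _ := UMagmaMorphism.copy evaluate (@free_lift K K id).

Lemma evaluate_gen x : evaluate (gen x) = x.
Proof. exact: free_lift_gen. Qed.

Lemma evaluate_relabel a u : evaluate (relabel a u) = evaluate u ^ a^-1.
Proof.
elim/gen_generated: u => [|x u IHu|x u IHu]; first by rewrite !gmulf1 conj1g.
  by rewrite !gmulfM conjMg /= IHu relabel_gen !evaluate_gen.
by rewrite !(gmulfM, gmulfV) conjMg conjVg /= IHu relabel_gen !evaluate_gen.
Qed.

(** The semidirect product of [free_group K] by K, acting through [relabel]. A
    separate name keeps the componentwise product of pairs from being found. *)
Definition sdp : Type := (free_group K * K)%type.

HB.instance Definition _ := Choice.on sdp.

Definition sdp_one : sdp := (1, 1).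
Definition sdp_mul (p q : sdp) : sdp := (p.1 * relabel p.2 q.1, p.2 * q.2).
Definition sdp_inv (p : sdp) : sdp := (relabel p.2^-1 p.1^-1, p.2^-1).

Lemma sdp_mulA : associative sdp_mul.
Proof.
by move=> p q r; rewrite /sdp_mul /= gmulfM relabelM !mulgA.
Qed.

Lemma sdp_mul1 : left_id sdp_one sdp_mul.
Proof. by case=> u a; rewrite /sdp_mul /= relabel1 !mul1g. Qed.

Lemma sdp_mulr1 : right_id sdp_one sdp_mul.
Proof. by case=> u a; rewrite /sdp_mul /= gmulf1 !mulg1. Qed.

Lemma sdp_mulV : left_inverse sdp_one sdp_inv sdp_mul.
Proof.
by case=> u a; rewrite /sdp_mul /= -gmulfM !mulVg gmulf1.
Qed.

Lemma sdp_mulrV : right_inverse sdp_one sdp_inv sdp_mul.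
Proof.
by case=> u a; rewrite /sdp_mul /= -relabelM !mulgV relabel1 mulgV.
Qed.

HB.instance Definition _ := isGroup.Build sdp
  sdp_mulA sdp_mul1 sdp_mulr1 sdp_mulV sdp_mulrV.

(** Named projection, since [snd] is already a morphism for the
    componentwise structure. *)
Definition label_of (p : sdp) : K := p.2.

Lemma label_of_morphism : monoid_morphism label_of.
Proof. by []. Qed.

HB.instance Definition _ :=
  isUMagmaMorphism.Build sdp K label_of label_of_morphism.

Definition collapse (p : sdp) : K := evaluate p.1 * p.2.

(** Evaluation is equivariant ([evaluate_relabel]), hence extends to the
    semidirect product. *)
Lemma collapse_morphism : monoid_morphism collapse.
Proof.
split=> [|p q]; first by rewrite /collapse /= gmulf1 mulg1.
rewrite /collapse /= gmulfM /= evaluate_relabel conjgE invgK !mulgA.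
by rewrite mulgVK.
Qed.

HB.instance Definition _ :=
  isUMagmaMorphism.Build sdp K collapse collapse_morphism.

(** The action of the semidirect product on the cosets of its factor K. *)
Definition sdp_act (p : sdp) (w : free_group K) : free_group K :=
  p.1 * relabel p.2 w.

Lemma sdp_act1 w : sdp_act 1 w = w.
Proof. by rewrite /sdp_act relabel1 mul1g. Qed.

Lemma sdp_actM p q w : sdp_act (p * q) w = sdp_act p (sdp_act q w).
Proof. by rewrite /sdp_act /= gmulfM relabelM mulgA. Qed.

(** Edges labelled by a generator are sent to edges labelled by a generator,
    never by the inverse of one: the action preserves orientations. *)
Lemma sdp_act_gen p w x :
  sdp_act p (w * gen x) = sdp_act p w * gen (x ^ p.2^-1).
Proof. by rewrite /sdp_act gmulfM /= relabel_gen mulgA. Qed.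

Lemma sdp_act_adj p u v :
  cayley_adj (sdp_act p u) (sdp_act p v) = cayley_adj u v.
Proof.
have half q s t : cayley_adj s t -> cayley_adj (sdp_act q s) (sdp_act q t).
  move/cayley_adj_gen=> [x st]; apply/cayley_adj_gen.
  by exists (x ^ q.2^-1); case: st => ->; rewrite sdp_act_gen; [left|right].
apply/idP/idP => [/(half p^-1)|]; last exact: half.
by rewrite -!sdp_actM mulVg !sdp_act1.
Qed.

Variables (L : groupType) (phi : UMagmaMorphism.type L sdp).

Definition cayley_action : tree_action L (cayley_tree K).
Proof.
refine (@TreeAction L (cayley_tree K) (fun g => sdp_act (phi g)) _ _ _).
- by move=> w; rewrite gmulf1; exact: sdp_act1.
- by move=> g h w; rewrite gmulfM; exact: sdp_actM.
- by move=> g u v; exact: sdp_act_adj.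
Defined.

(** An inverted edge would, orientations being preserved, give two generators
    whose product is 1. *)
Lemma cayley_action_without_inversion : without_inversion cayley_action.
Proof.
have oriented g u x : sdp_act g u = u * gen x -> sdp_act g (u * gen x) <> u.
  rewrite sdp_act_gen => ->; rewrite -mulgA -{2}[u]mulg1 => /mulgI.
  exact: gen_mul_gen_neq1.
move=> g u v /cayley_adj_gen[x [->|->]] [gu gv].
  exact: oriented gu gv.
exact: oriented gv gu.
Qed.

End SemidirectProduct.

(** Evaluating the equation [p.1 * relabel p.2 w = w] in K turns relabelling
    into conjugation; what remains is a conjugacy in K. *)
Lemma fixed_vertex_conj (K : groupType) (p : sdp K) (w : free_group K) :
  sdp_act p w = w -> collapse p = label_of p ^ (evaluate w)^-1.
Proof.
move/(congr1 (@evaluate K)); rewrite gmulfM /= evaluate_relabel conjgE invgK.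
rewrite !mulgA -/(collapse p) => pw.
by rewrite conjgE invgK -{1}pw mulgA mulgVK mulgK.
Qed.

(** * Splitting a right-angled Artin group along a vertex *)

Section RightAngled.

Variables (Gamma : labeled_graph) (hGamma : right_angled Gamma).

Local Notation A := (artin_group Gamma).
Local Notation V := (vertices Gamma).

Lemma right_angled_label (v w : V) :
  [set v; w] \in edges Gamma -> label [set v; w] = 2.
Proof.
case: hGamma => [-> | labels] vw; first by rewrite inE in vw.
by apply/eqP; have := image_f (@label Gamma) vw; rewrite labels inE.
Qed.

Lemma right_angled_respects (G : groupType) (f : V -> G) :
  (forall v w, [set v; w] \in edges Gamma -> commute (f v) (f w)) ->
  respects (@artin_relation Gamma) f.
Proof.
move=> fC _ _ [v w vw]; rewrite (right_angled_label vw) /= /word_value.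
by rewrite !big_cons !big_nil /letter_value /= !mulg1; exact: fC.
Qed.

Lemma gen_commute (v w : V) :
  [set v; w] \in edges Gamma -> commute (gen v : A) (gen w).
Proof.
move=> vw; rewrite /commute -!class_of_word_cat; apply/class_of_wordP.
by have := ArtinRelation vw; rewrite (right_angled_label vw) => /word_eq_rel.
Qed.

(** The stable letter v becomes a basis element of the free group, namely the
    one labelled by v; the other generators act on labels by conjugation. *)
Definition split_gen (v w : V) : sdp A :=
  if w == v then (gen (gen v : A), 1) else (1, gen w).

Lemma split_gen_respects v : respects (@artin_relation Gamma) (split_gen v).
Proof.
have gen_label w : [set v; w] \in edges Gamma ->
    commute ((gen (gen v : A), 1) : sdp A) (1, gen w).
  move=> vw; congr (_, _); last by rewrite /= mul1g mulg1.
  rewrite /= relabel_gen mul1g gmulf1 mulg1; congr gen.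
  by rewrite conjgE invgK mulgA -(gen_commute vw) mulgK.
apply: right_angled_respects => w1 w2 w12; rewrite /split_gen.
case: eqP => [e1|_]; case: eqP => [e2|_] //.
- by rewrite e1 in w12; exact: gen_label.
- by rewrite e2 setUC in w12; apply: commute_sym; exact: gen_label.
- congr (_, _); first by rewrite /= !gmulf1.
  exact: gen_commute.
Qed.

Definition splitting v : A -> sdp A := lift (split_gen_respects v).

HB.instance Definition _ v :=
  UMagmaMorphism.copy (splitting v) (lift (split_gen_respects v)).

(** This makes [splitting v] injective, and it is what lets a conjugacy
    between [collapse] and [label_of] be read in the Artin group. *)
Lemma splittingK v : cancel (splitting v) (@collapse A).
Proof.
move=> g.
apply: (morphism_ext (f := @collapse A \o splitting v) (g := idfun)) => w.
rewrite /= [splitting v _]lift_gen /split_gen /collapse.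
by case: eqP => [->|_]; rewrite /= ?gmulf1 ?evaluate_gen (mulg1, mul1g).
Qed.

Definition kill v : A -> A := @label_of A \o splitting v.

HB.instance Definition _ v :=
  UMagmaMorphism.copy (kill v) (@label_of A \o splitting v).

Lemma kill_gen v w : kill v (gen w) = if w == v then 1 else gen w.
Proof. by rewrite /kill /= [splitting v _]lift_gen /split_gen; case: eqP. Qed.

(** If x is conjugate to its image under an endomorphism f and under an
    endomorphism g, applying f to the second conjugacy shows that x is conjugate
    to f (g x). By induction x is conjugate to its image under the composite of
    all the [kill v], which is trivial. *)
Lemma conj_kill_trivial (g : A) :
  (forall v, exists h, g = kill v g ^ h) -> g = 1.
Proof.
move=> g_kill; pose kill_all s (x : A) := foldr kill x s.
have kill_allM s : monoid_morphism (kill_all s).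
  by elim: s => [//|v s IHs]; split=> [|x y] /=; rewrite IHs (gmulf1, gmulfM).
have kill_all_gen s w :
    kill_all s (gen w) = if w \in s then 1 else gen w.
  elim: s => //= v s ->; rewrite inE; case: (w \in s).
    by rewrite orbT gmulf1.
  by rewrite orbF kill_gen.
have [h ->] : exists h, g = kill_all (enum V) g ^ h.
  elim: (enum V) => [|v s [h def_g]]; first by exists 1; rewrite conjg1.
  have [k {1}->] := g_kill v; exists (kill v h * k).
  by rewrite {1}def_g gmulfJ conjgM.
have kill_all1 : kill_all (enum V) g = 1; last by rewrite kill_all1 conj1g.
pose f : UMagmaMorphism.type A A :=
  HB.pack (kill_all (enum V)) (isUMagmaMorphism.Build A A _ (kill_allM _)).
apply: (morphism_ext (f := f) (g := @one_fun A A)) => w.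
by rewrite /= kill_all_gen mem_enum.
Qed.

End RightAngled.

Theorem corollary1p4 (Gamma : labeled_graph) (hGamma : right_angled Gamma)
    (H : groupClosed (artin_group Gamma)) (hH : FA'_group (subgroup_type H)) :
  forall x : artin_group Gamma, x \in H -> x = 1.
Proof.
move=> x xH; apply: (conj_kill_trivial (hGamma := hGamma)) => v.
pose phi : UMagmaMorphism.type (subgroup_type H) (sdp (artin_group Gamma)) :=
  splitting hGamma v \o val.
have [w fix_w] :=
  hH _ _ (@cayley_action_without_inversion _ _ phi) (exist _ x xH).
exists (evaluate w)^-1.
by rewrite -(fixed_vertex_conj fix_w) /= splittingK.
Qed.
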